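(* Let $\{w^k\}$, $w^k=(x^k,y^k,\lambda^k)$, be a sequence generated by the iPSPR iteration with stepsizes $(\alpha,\gamma)\in\mathbb{D}$ and symmetric (possibly indefinite) proximal matrices $S,T$. Suppose that $$S+\tfrac12\Sigma_1\succeq 0,\qquad S+\tfrac12\Sigma_1+\beta A^{\mathsf T}A\succ 0,$$ and $$T+\Sigma_2+(1-\alpha)\beta B^{\mathsf T}B\succ 0,\qquad T+\tfrac12\Sigma_2+\kappa_1^{\alpha,\gamma}(-2T_-+\Sigma_2)+\kappa_2^{\alpha,\gamma}\beta B^{\mathsf T}B\succ 0.$$ Then $\{w^k\}$ converges to an optimal solution of the problem, i.e. to a point of $\Omega^*$.
   Context: **Problem.** $\min\ \theta_1(x)+\theta_2(y)$ s.t. $Ax+By=b$, $x\in\mathcal X=\mathbb R^{n_1}$, $y\in\mathcal Y=\mathbb R^{n_2}$, with $A\in\mathbb R^{m\times n_1}$, $B\in\mathbb R^{m\times n_2}$, $b\in\mathbb R^m$. Here $\theta_1=p+f$, $\theta_2=h+g$, where $p:\mathcal X\to(-\infty,+\infty]$, $h:\mathcal Y\to(-\infty,+\infty]$ are proper closed convex and $f:\mathcal X\to\mathbb R$, $g:\mathcal Y\to\mathbb R$ are convex with Lipschitz continuous gradients. Let $\Omega=\mathcal X\times\mathcal Y\times\mathbb R^m$, $w=(x,y,\lambda)$. $\Omega^*$ is the set of primal-dual optimal solutions: $w^*=(x^*,y^*,\lambda^* )$ with $Ax^*+By^*=b$, $A^{\mathsf T}\lambda^*\in\partial\theta_1(x^*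 )$, $B^{\mathsf T}\lambda^*\in\partial\theta_2(y^* )$. It is assumed that $\Omega^*\neq\emptyset$. **Convexity matrices.** $\Sigma_1,\Sigma_2$ are fixed symmetric positive semidefinite matrices with $\langle x-x',\xi_x-\xi_x'\rangle\ge\|x-x'\|_{\Sigma_1}^2$ for all $x,x'$, $\xi_x\in\partial\theta_1(x)$, $\xi_x'\in\partial\theta_1(x')$, and $\langle y-y',\xi_y-\xi_y'\rangle\ge\|y-y'\|_{\Sigma_2}^2$ for all $y,y'$, $\xi_y\in\partial\theta_2(y)$, $\xi_y'\in\partial\theta_2(y')$. For symmetric (possibly indefinite) $G$, $\|z\|_G^2:=z^{\mathsf T}Gz$. **iPSPR iteration.** Let $\beta>0$ and $\mathcal L_\beta(x,y,\lambda)=\theta_1(x)+\theta_2(y)-\langle\lambda,Ax+By-b\rangle+\frac\beta2\|Ax+By-b\|^2$. Given $w^0\in\Omega$, for $k\ge 0$: $x^{k+1}=\arg\min_{x\in\mathcal X}\mathcal L_\beta(x,y^k,\lambda^k)+\frac12\|x-x^k\|_S^2$; $\lambda^{k+1/2}=\lambda^k-\alpha\beta(Ax^{k+1}+By^k-b)$; $y^{k+1}=\arg\min_{y\in\mathcal Y}\mathcal L_\beta(x^{k+1},y,\lambda^{k+1/2})+\frac12\|y-y^k\|_T^2$; $\lambda^{k+1}=\lambda^{k+1/2}-\gamma\beta(Ax^{k+1}+By^{k+1}-b)$. $S,T$ are symmetric; $T=T_+-T_-$ is a fixed decomposition with $T_+\succeq0$, $T_-\succeq0$. **Stepsize domain.**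 $\mathbb D=\{(\alpha,\gamma):0\le\alpha<1,\ 0\le\gamma<\frac{1-\alpha+\sqrt{(1+\alpha)^2+4(1-\alpha^2)}}2,\ \alpha+\gamma>0\}=\mathbb D_1\cup\mathbb D_2\cup\mathbb D_3\cup\mathbb D_4$, with $\mathbb D_1=\{0\le\alpha<1<\gamma<\frac{1-\alpha+\sqrt{(1+\alpha)^2+4(1-\alpha^2)}}2\}$, $\mathbb D_2=\{0\le\alpha<1,\gamma=1\}$, $\mathbb D_3=\{0\le\alpha<1,0\le\gamma<1,\alpha+\gamma>0,\alpha\ne\gamma\}$, $\mathbb D_4=\{0<\alpha=\gamma<1\}$. **Constants.** $c^{\alpha,\gamma}$ is a fixed number in $\left(0,\frac{1-\alpha^2+\alpha-(\alpha-1)\gamma-\gamma^2}{(2-\alpha-\gamma)(1+\alpha)}\right)$ if $(\alpha,\gamma)\in\mathbb D_1$ and in $(0,1)$ if $(\alpha,\gamma)\in\mathbb D_2\cup\mathbb D_3$ (not needed on $\mathbb D_4$). $\kappa_1^{\alpha,\gamma}=\frac{2(1-\alpha)}{1+\alpha}$ on $\mathbb D_1$, $\frac{1-\alpha}{1+\alpha}$ on $\mathbb D_2$, $0$ on $\mathbb D_3\cup\mathbb D_4$. $\kappa_2^{\alpha,\gamma}=\frac{c^{\alpha,\gamma}(1-\alpha)^2}{1+\alpha}$ on $\mathbb D_1$, $\frac{c^{\alpha,\gamma}(1-\alpha)(3-\alpha)}{4(1+\alpha)}$ on $\mathbb D_2$, $\frac{c^{\alpha,\gamma}(1-\alpha)(1-\gamma)}{2-\gamma-\alpha}$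 on $\mathbb D_3$, $\frac{1-\alpha}2$ on $\mathbb D_4$. *)

(* Defs.v *)
From HB Require Import structures.
From mathcomp Require Import all_boot all_order all_algebra.
From mathcomp Require Import all_classical all_reals all_analysis.
From mathcomp Require Import ring lra.

Set Implicit Arguments.
Unset Strict Implicit.
Unset Printing Implicit Defensive.

Import Order.TTheory GRing.Theory Num.Theory.
Import numFieldNormedType.Exports.

Local Open Scope classical_set_scope.
Local Open Scope ring_scope.

Section Forms.
Context {R : realType} {n : nat}.
Implicit Types (u v z : 'cV[R]_n) (G : 'M[R]_n).

Definition dot u v : R := (u^T *m v) 0 0.

(* z^T G z; not a squared norm when G is indefinite *)
Definition qform G z : R := (z^T *m G *m z) 0 0.

Definition psd G : Prop := G^T = G /\ forall z, 0 <= qform G z.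

Definition pd G : Prop := G^T = G /\ forall z, z != 0 -> 0 < qform G z.

End Forms.

Section ConvexFunctions.
Context {R : realType} {n : nat}.
Implicit Types (phi : 'cV[R]_n -> \bar R) (f : 'cV[R]_n -> R).

Definition proper_function phi : Prop :=
  (forall x, -oo < phi x)%E /\ (exists x, phi x < +oo)%E.

(* For proper phi the right-hand side is never oo - oo, and 0 * +oo = 0 makes
   the inequality trivial for t = 0 and t = 1. *)
Definition convex_ereal phi : Prop :=
  forall (t : R) x y, 0 <= t <= 1 ->
    (phi (t *: x + (1 - t) *: y)%R <= t%:E * phi x + (1 - t)%:E * phi y)%E.

(* "closed" in the sense of convex analysis: the epigraph is closed *)
Definition closed_function phi : Prop :=
  closed [set z : 'cV[R]_n * R | (phi z.1 <= z.2%:E)%E].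

Definition proper_closed_convex phi : Prop :=
  [/\ proper_function phi, closed_function phi & convex_ereal phi].

Definition gradient f (x : 'cV[R]_n) : 'cV[R]_n :=
  \col_i 'D_(delta_mx i 0) f x.

(* The library's Lipschitz predicate uses the sup norm on column vectors; the
   Euclidean norm would only change the constant. *)
Definition convex_lipschitz_gradient f : Prop :=
  [/\ convex_function [set: _] f,
      forall x, differentiable f x
    & lipschitz (gradient f)].

Definition composite phi f : 'cV[R]_n -> \bar R :=
  fun x => (phi x + (f x)%:E)%E.

(* empty outside the effective domain as soon as theta is proper *)
Definition subdifferential (theta : 'cV[R]_n -> \bar R) (x : 'cV[R]_n) :
    set 'cV[R]_n :=
  [set xi | forall z, (theta x + (dot xi (z - x))%:E <= theta z)%E].

Definition convexity_matrix (theta : 'cV[R]_n -> \bar R) (Sigma : 'M[R]_n) :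
    Prop :=
  psd Sigma /\
  forall x x' xi xi', subdifferential theta x xi ->
    subdifferential theta x' xi' ->
    qform Sigma (x - x') <= dot (x - x') (xi - xi').

Definition argmin (F : 'cV[R]_n -> \bar R) : set 'cV[R]_n :=
  [set x | forall z, (F x <= F z)%E].

End ConvexFunctions.

Section Problem.
Context {R : realType} {n1 n2 m : nat}.
Variables (theta1 : 'cV[R]_n1 -> \bar R) (theta2 : 'cV[R]_n2 -> \bar R).
Variables (A : 'M[R]_(m, n1)) (B : 'M[R]_(m, n2)) (b : 'cV[R]_m).

Definition optimal_set : set ('cV[R]_n1 * 'cV[R]_n2 * 'cV[R]_m) :=
  [set w | [/\ A *m w.1.1 + B *m w.1.2 = b,
               subdifferential theta1 w.1.1 (A^T *m w.2)
             & subdifferential theta2 w.1.2 (B^T *m w.2)]].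

Definition residual (x : 'cV[R]_n1) (y : 'cV[R]_n2) : 'cV[R]_m :=
  A *m x + B *m y - b.

Definition aug_lagrangian (beta : R) x y (lambda : 'cV[R]_m) : \bar R :=
  (theta1 x + theta2 y
   + (- dot lambda (residual x y)
      + beta / 2 * dot (residual x y) (residual x y))%:E)%E.

End Problem.

(* In the x-subproblem theta2 (y k) is an additive constant and is dropped
   (theta2 replaced by 0): the starting point y 0 is arbitrary, and if
   theta2 (y 0) = +oo then keeping the constant would make every x a minimizer.
   When theta2 (y k) is finite this changes nothing, see argmin_x_subproblem.
   In the y-subproblem theta1 (x k.+1) is always finite. *)
Definition iPSPR {R : realType} {n1 n2 m : nat}
    (theta1 : 'cV[R]_n1 -> \bar R) (theta2 : 'cV[R]_n2 -> \bar R)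
    (A : 'M[R]_(m, n1)) (B : 'M[R]_(m, n2)) (b : 'cV[R]_m)
    (beta alpha gamma : R) (S : 'M[R]_n1) (T : 'M[R]_n2)
    (x : nat -> 'cV[R]_n1) (y : nat -> 'cV[R]_n2) (lambda : nat -> 'cV[R]_m) :
    Prop :=
  forall k : nat,
    let lambda_half :=
      lambda k - (alpha * beta) *: residual A B b (x k.+1) (y k) in
    [/\ argmin (fun u =>
          aug_lagrangian theta1 (fun=> 0%E) A B b beta u (y k) (lambda k)
          + (2^-1 * qform S (u - x k))%:E)%E (x k.+1),
        argmin (fun v =>
          aug_lagrangian theta1 theta2 A B b beta (x k.+1) v lambda_half
          + (2^-1 * qform T (v - y k))%:E)%E (y k.+1)
      & lambda k.+1 =
          lambda_half - (gamma * beta) *: residual A B b (x k.+1) (y k.+1)].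

Lemma argmin_x_subproblem {R : realType} {n1 n2 m : nat}
    (theta1 : 'cV[R]_n1 -> \bar R) (theta2 : 'cV[R]_n2 -> \bar R)
    (A : 'M[R]_(m, n1)) (B : 'M[R]_(m, n2)) (b : 'cV[R]_m) (beta : R)
    (S : 'M[R]_n1) (x : 'cV[R]_n1) (y : 'cV[R]_n2) (lambda : 'cV[R]_m) :
  theta2 y \is a fin_num ->
  argmin (fun u => aug_lagrangian theta1 (fun=> 0%E) A B b beta u y lambda
                   + (2^-1 * qform S (u - x))%:E)%E
  = argmin (fun u => aug_lagrangian theta1 theta2 A B b beta u y lambda
                     + (2^-1 * qform S (u - x))%:E)%E.
Proof.
move=> fin2; have E u :
    (aug_lagrangian theta1 theta2 A B b beta u y lambda
       + (2^-1 * qform S (u - x))%:E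
     = (aug_lagrangian theta1 (fun=> 0) A B b beta u y lambda
       + (2^-1 * qform S (u - x))%:E) + theta2 y)%E.
  by rewrite /aug_lagrangian adde0 (addeAC (theta1 u)) (addeAC _ (theta2 y)).
by apply/seteqP; split=> u /= h z; have := h z; rewrite !E leeD2rE.
Qed.

Section Stepsizes.
Context {R : realType}.
Implicit Types alpha gamma c : R.

Definition gamma_bound alpha : R :=
  (1 - alpha + Num.sqrt ((1 + alpha) ^+ 2 + 4 * (1 - alpha ^+ 2))) / 2.

Definition domD alpha gamma : bool :=
  [&& 0 <= alpha, alpha < 1, 0 <= gamma, gamma < gamma_bound alpha
    & 0 < alpha + gamma].

Definition domD1 alpha gamma : bool :=
  [&& 0 <= alpha, alpha < 1, 1 < gamma & gamma < gamma_bound alpha].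

Definition domD2 alpha gamma : bool :=
  [&& 0 <= alpha, alpha < 1 & gamma == 1].

Definition domD3 alpha gamma : bool :=
  [&& 0 <= alpha, alpha < 1, 0 <= gamma, gamma < 1, 0 < alpha + gamma
    & alpha != gamma].

Definition domD4 alpha gamma : bool :=
  [&& 0 < alpha, alpha == gamma & gamma < 1].

Lemma domDE alpha gamma :
  domD alpha gamma = [|| domD1 alpha gamma, domD2 alpha gamma,
                         domD3 alpha gamma | domD4 alpha gamma].
Proof.
have gb : 0 <= alpha -> alpha < 1 -> 1 < gamma_bound alpha.
  move=> a0 a1; rewrite /gamma_bound ltr_pdivlMr// mul1r -ltrBlDl.
  have -> : 2 - (1 - alpha) = Num.sqrt ((1 + alpha) ^+ 2).
    by rewrite sqrtr_sqr ger0_norm; lra.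
  by rewrite ltr_sqrt; nra.
apply/idP/idP => [/and5P[a0 a1 g0 gB ag]|].
  rewrite /domD1 /domD2 /domD3 /domD4 a0 a1 g0 gB ag/= andbT.
  case: (ltgtP gamma 1) => //= g1; case: (eqVneq alpha gamma) => //= e.
  by rewrite andbT; lra.
rewrite /domD /domD1 /domD2 /domD3 /domD4.
case/or4P=> [/and4P[a0 a1 g1 gB]|/and3P[a0 a1 /eqP->]
  |/and5P[a0 a1 g0 g1 /andP[ag _]]|/and3P[a0 /eqP<- a1]].
- by rewrite a0 a1 gB/=; apply/andP; split; lra.
- by rewrite a0 a1 gb//=; apply/andP; split; lra.
- by rewrite a0 a1 g0 ag/= andbT; apply: lt_trans (gb _ _).
- have a0' := ltW a0; rewrite a0' a1 (lt_trans a1 (gb _ _))//=.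
  by rewrite addr_gt0.
Qed.

Definition admissible_c alpha gamma c : Prop :=
  (domD1 alpha gamma ->
     0 < c < (1 - alpha ^+ 2 + alpha - (alpha - 1) * gamma - gamma ^+ 2)
             / ((2 - alpha - gamma) * (1 + alpha))) /\
  (domD2 alpha gamma || domD3 alpha gamma -> 0 < c < 1).

(* The domains D1, ..., D4 are pairwise disjoint; the final value 0 of kappa2 is
   only taken outside of their union. *)
Definition kappa1 alpha gamma : R :=
  if domD1 alpha gamma then 2 * (1 - alpha) / (1 + alpha)
  else if domD2 alpha gamma then (1 - alpha) / (1 + alpha)
  else 0.

Definition kappa2 alpha gamma c : R :=
  if domD1 alpha gamma then c * (1 - alpha) ^+ 2 / (1 + alpha)
  else if domD2 alpha gamma then
    c * (1 - alpha) * (3 - alpha) / (4 * (1 + alpha))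
  else if domD3 alpha gamma then
    c * (1 - alpha) * (1 - gamma) / (2 - gamma - alpha)
  else if domD4 alpha gamma then (1 - alpha) / 2
  else 0.

End Stepsizes.

(* Main.v *)
Require Import Defs.
From mathcomp Require Import all_boot all_order all_algebra.
From mathcomp Require Import all_classical all_reals all_analysis.
From mathcomp Require Import ring lra.

Set Implicit Arguments.
Unset Strict Implicit.
Unset Printing Implicit Defensive.

Import Order.TTheory GRing.Theory Num.Theory.
Import numFieldNormedType.Exports.

Local Open Scope classical_set_scope.
Local Open Scope ring_scope.

(** The proof is a Lyapunov argument of Fejer type.  Each subproblem contributes
    its first-order optimality condition, a subgradient of the convex part at
    the new iterate; this needs convexity of [theta1] and [theta2] only, not of
    the proximal terms ([argmin_subdifferential]).  Paired with the optimality
    conditions at a solution, the two conditions of one iteration add up to a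
    descent inequality.  The proximal terms give it through
    [prox_step_le], where half of the strong monotonicity [Sigma] compensates
    the indefiniteness of [S] and [T]; the coupling and the multiplier give an
    exact identity ([dual_energy_step]) once the multiplier is shifted to
    [mu = lambda - alpha beta B y].  With [r] the new residual and [d] the
    change of [B y], the decrease contains
    [beta ((2 - alpha - gamma) |r|^2 - 2 (1 - alpha) r.d + (1 - alpha) |d|^2)],
    a form that is indefinite for [gamma > 1] and degenerate for [gamma = 1].

    For [gamma >= 1] the product [r.d] is therefore bounded from above by
    monotonicity of the subdifferential of [theta2] between consecutive iterates
    ([consecutive_prox_steps]).  The price is
    [kappa1 (2 Tminus - Sigma2)] and terms that telescope, and [stepsize_gap]
    shows that what remains dominates [kappa2 beta |d|^2] plus a multiple of
    [|r - theta d|^2].  This is exactly what the second condition on [T] turns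
    into a positive definite decrement, so that the augmented energy decreases
    ([energy_descent]) and its decrements tend to zero.  Hence consecutive
    iterates approach each other and the constraint holds in the limit
    ([asymptotic_regularity]).

    The energy bounds the iterates; a limit along an ultrafilter finer than the
    cofinite filter is optimal, because the graph of the subdifferential is
    closed ([ultra_limit_optimal]).  Since the energy decreases with respect to
    every solution, it may be measured from this limit: it tends to zero along
    the ultrafilter, hence along the whole sequence, and
    [optimality_sequence_cvg] reads off convergence of the three blocks. *)

(** * Inner products and quadratic forms *)

Section Dot.
Context {R : realType} {n : nat}.
Implicit Types (u v z : 'cV[R]_n) (G : 'M[R]_n).

Lemma dotE u v : dot u v = \sum_i u i 0 * v i 0.
Proof. by rewrite /dot mxE; apply: eq_bigr => i _; rewrite mxE. Qed.

Lemma dotC u v : dot u v = dot v u.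
Proof. by rewrite !dotE; apply: eq_bigr => i _; rewrite mulrC. Qed.

Lemma dotDr z u v : dot z (u + v) = dot z u + dot z v.
Proof. by rewrite /dot mulmxDr mxE. Qed.

Lemma dotNr z u : dot z (- u) = - dot z u.
Proof. by rewrite /dot mulmxN mxE. Qed.

Lemma dotZr a z u : dot z (a *: u) = a * dot z u.
Proof. by rewrite /dot -scalemxAr mxE. Qed.

Lemma dotDl u v z : dot (u + v) z = dot u z + dot v z.
Proof. by rewrite dotC dotDr !(dotC z). Qed.

Lemma dotNl u z : dot (- u) z = - dot u z.
Proof. by rewrite dotC dotNr (dotC z). Qed.

Lemma dotZl a u z : dot (a *: u) z = a * dot u z.
Proof. by rewrite dotC dotZr (dotC z). Qed.

Definition dot_lin := (dotDl, dotDr, dotNl, dotNr, dotZl, dotZr).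

Lemma dot_ge0 u : 0 <= dot u u.
Proof. by rewrite dotE; apply: sumr_ge0 => i _; rewrite -expr2 sqr_ge0. Qed.

Lemma sqr_entry_le_dot u i : u i 0 ^+ 2 <= dot u u.
Proof.
rewrite dotE (bigD1 i)//= -expr2 lerDl.
by apply: sumr_ge0 => j _; rewrite -expr2 sqr_ge0.
Qed.

Lemma dot_eq0 u : dot u u = 0 -> u = 0.
Proof.
move=> u0; apply/matrixP => i j; rewrite mxE (ord1 j).
by apply/eqP; rewrite -sqrf_eq0 eq_le sqr_ge0 andbT -u0 sqr_entry_le_dot.
Qed.

Lemma qformE G z : qform G z = dot z (G *m z).
Proof. by rewrite /qform /dot mulmxA. Qed.

Lemma qformD G H z : qform (G + H) z = qform G z + qform H z.
Proof. by rewrite !qformE mulmxDl dotDr. Qed.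

Lemma qformN G z : qform (- G) z = - qform G z.
Proof. by rewrite !qformE mulNmx dotNr. Qed.

Lemma qformZ a G z : qform (a *: G) z = a * qform G z.
Proof. by rewrite !qformE -scalemxAl dotZr. Qed.

End Dot.

Section Adjoint.
Context {R : realType} {m n : nat}.
Implicit Types (A : 'M[R]_(m, n)) (u v : 'cV[R]_n).

Lemma dot_mulmxl A u (w : 'cV[R]_m) : dot (A *m u) w = dot u (A^T *m w).
Proof. by rewrite /dot trmx_mul mulmxA. Qed.

Lemma qform_gram A u : qform (A^T *m A) u = dot (A *m u) (A *m u).
Proof. by rewrite qformE -mulmxA -dot_mulmxl. Qed.

End Adjoint.

Lemma dot_sym_mulmx {R : realType} {n : nat} (G : 'M[R]_n) u v :
  G^T = G -> dot u (G *m v) = dot v (G *m u).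
Proof. by move=> Gs; rewrite dotC dot_mulmxl Gs. Qed.

Lemma qform_polar {R : realType} {n : nat} (G : 'M[R]_n) u v : G^T = G ->
  qform G (u + v) = qform G u + qform G v + 2 * dot u (G *m v).
Proof.
move=> Gs; rewrite !qformE mulmxDr !dot_lin (dot_sym_mulmx v u Gs).
by ring.
Qed.

Lemma qform_polarB {R : realType} {n : nat} (G : 'M[R]_n) u v : G^T = G ->
  qform G (u - v) = qform G u + qform G v - 2 * dot u (G *m v).
Proof.
move=> Gs; rewrite qform_polar// mulmxN dotNr !qformE mulmxN !dot_lin.
by ring.
Qed.

(** This half-sum form of Cauchy's inequality turns products of consecutive
    steps into terms that telescope. *)
Lemma psd_cross_le {R : realType} {n : nat} (G : 'M[R]_n) u v : psd G ->
  `|2 * dot u (G *m v)| <= qform G u + qform G v.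
Proof.
move=> [Gs G0]; rewrite ler_norml.
have := G0 (u + v); have := G0 (u - v); rewrite qform_polarB// qform_polar//.
by move=> h1 h2; apply/andP; split; lra.
Qed.

(** * One iteration *)

(** A proximal step with an indefinite matrix [G]: strong monotonicity is spent
    twice.  Half of it moves [Sigma] into the Lyapunov weight, and the
    parallelogram inequality
    [|e|^2 + |e'|^2 >= |e' - e|^2 / 2] turns the rest into the
    [Sigma / 2] that makes up for the indefiniteness of [G]. *)
Lemma prox_step_le {R : realType} {n : nat} (G Sigma : 'M[R]_n)
    (e e' g : 'cV[R]_n) :
  G^T = G -> psd Sigma ->
  qform Sigma e' <= dot e' (g - G *m (e' - e)) ->
  qform (G + Sigma) e' + qform (G + 2^-1 *: Sigma) (e' - e)
    <= qform (G + Sigma) e + 2 * dot e' g.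
Proof.
move=> Gs [Ss S0]; have := S0 (e' + e); rewrite qform_polar//.
rewrite !(qformD, qformZ) !qform_polarB// !(mulmxBr, dot_lin) -!qformE.
by lra.
Qed.

(** With [mu = l - alpha beta v] the multiplier updates collapse to
    [mu' = mu - (alpha + gamma) beta (a + v')], which is why the Lyapunov
    function below is a sum of two squares. *)
Definition dual_energy {R : realType} {m : nat} (beta alpha gamma : R)
    (v l : 'cV[R]_m) : R :=
  (1 - alpha) * beta * dot v v
  + (beta * (alpha + gamma))^-1
    * dot (l - (alpha * beta) *: v) (l - (alpha * beta) *: v).

Lemma dual_energy_step {R : realType} {m : nat} (beta alpha gamma : R)
    (a v v' l lh l' : 'cV[R]_m) :
  beta != 0 -> alpha + gamma != 0 ->
  lh = l - (alpha * beta) *: (a + v) ->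
  l' = lh - (gamma * beta) *: (a + v') ->
  2 * (dot a (l - beta *: (a + v)) + dot v' (lh - beta *: (a + v')))
  = dual_energy beta alpha gamma v l - dual_energy beta alpha gamma v' l'
    - beta * ((2 - alpha - gamma) * dot (a + v') (a + v')
              - 2 * (1 - alpha) * dot (a + v') (v' - v)
              + (1 - alpha) * dot (v' - v) (v' - v)).
Proof.
move=> b0 ag0 -> ->; rewrite /dual_energy !dot_lin.
rewrite (dotC v a) (dotC v' a) (dotC v' v) (dotC l a) (dotC l v) (dotC l v').
by field; rewrite ag0.
Qed.

(** Monotonicity between two consecutive proximal steps.  The indefinite
    product [d^T T d'] is split along [T = Tp - Tm]; estimating both parts by
    half-sums produces a difference of consecutive [Tp + Tm] energies, which
    telescopes, at the price of [2 d^T Tm d]. *)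
Lemma consecutive_prox_steps {R : realType} {n : nat} (T Tp Tm Sigma : 'M[R]_n)
    (d d' g : 'cV[R]_n) :
  T = Tp - Tm -> psd Tp -> psd Tm ->
  qform Sigma d <= dot d (g - T *m (d - d')) ->
  qform Sigma d - 2 * qform Tm d
    <= dot d g + 2^-1 * (qform (Tp + Tm) d' - qform (Tp + Tm) d).
Proof.
move=> -> pp pm; have := psd_cross_le d d' pp; have := psd_cross_le d d' pm.
rewrite !ler_norml => /andP[h1 _] /andP[_ h2].
rewrite !(mulmxBr, mulmxBl, dot_lin) -!qformE !qformD.
lra.
Qed.

(** * The stepsize constants *)

(** Squaring the bound on [gamma] shows that the numerator in the range of [c]
    is positive; it equals [(2 - alpha - gamma)(1 + alpha) - (gamma - 1)^2]. *)
Lemma gamma_bound_quadratic {R : realType} (alpha gamma : R) :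
  0 <= alpha -> alpha < 1 -> 1 < gamma -> gamma < gamma_bound alpha ->
  0 < 2 - alpha - gamma /\
  (gamma - 1) ^+ 2 < (2 - alpha - gamma) * (1 + alpha).
Proof.
move=> a0 a1 g1; rewrite /gamma_bound ltr_pdivlMr// -ltrBlDl => gB.
have D0 : 0 <= (1 + alpha) ^+ 2 + 4 * (1 - alpha ^+ 2) by nra.
have : (gamma * 2 - (1 - alpha)) ^+ 2 < (1 + alpha) ^+ 2 + 4 * (1 - alpha ^+ 2).
  by rewrite -[ltRHS]sqr_sqrtr// ltr_pXn2r// nnegrE ?sqrtr_ge0//; lra.
move=> q; split; last by nra.
have [//|h] := ltP 0 (2 - alpha - gamma).
have : (2 - alpha) * 1 <= gamma * (gamma - 1 + alpha) by apply: ler_pM; lra.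
nra.
Qed.

(** The domains [D3] and [D4] share one case: on [D4] the value of [kappa2] is
    the one that the formula of [D3] gives for [c = 1].  Outside [D1] the slack
    [c < 1] can be given up, and only the bound by the value at [c = 1] is
    kept. *)
Lemma domD_case {R : realType} (alpha gamma c : R) :
  domD alpha gamma -> admissible_c alpha gamma c ->
  [\/ [/\ [/\ 0 <= alpha < 1, 1 < gamma & 0 < 2 - alpha - gamma],
          0 < c < 1,
          (gamma - 1) ^+ 2 < (1 - c) * ((2 - alpha - gamma) * (1 + alpha)),
          kappa1 alpha gamma = 2 * (1 - alpha) / (1 + alpha)
        & kappa2 alpha gamma c = c * (1 - alpha) ^+ 2 / (1 + alpha)],
      [/\ 0 <= alpha < 1, gamma = 1,
          kappa1 alpha gamma = (1 - alpha) / (1 + alpha)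
        & kappa2 alpha gamma c
            <= (1 - alpha) * (3 - alpha) / (4 * (1 + alpha))]
    | [/\ 0 <= alpha < 1, 0 <= gamma < 1,
          kappa1 alpha gamma = 0
        & kappa2 alpha gamma c
            <= (1 - alpha) * (1 - gamma) / (2 - gamma - alpha)]].
Proof.
rewrite domDE => hD [hc1 hc2].
have [D1|nD1] := boolP (domD1 alpha gamma).
  apply: Or31; have /andP[c0] := hc1 D1.
  have /and4P[a0 a1 g1 gB] := D1.
  have [g2 gq] := gamma_bound_quadratic a0 a1 g1 gB.
  have p0 : 0 < (2 - alpha - gamma) * (1 + alpha) by apply: mulr_gt0 => //; lra.
  rewrite ltr_pdivlMr// => cB; have gg : 0 < (gamma - 1) ^+ 2.
    by apply: exprn_gt0; lra.
  split; rewrite /kappa1 /kappa2 ?D1 ?a0 ?c0//=; last by nra.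
  by rewrite -(ltr_pM2r p0) mul1r; nra.
have [D2|nD2] := boolP (domD2 alpha gamma).
  apply: Or32; have /andP[c0 c1] : 0 < c < 1 by apply: hc2; rewrite D2.
  have /and3P[a0 a1 /eqP g1] := D2.
  split; rewrite /kappa1 /kappa2 ?(negPf nD1) ?D2 ?a0//=.
  rewrite ler_pM2r ?invr_gt0; last by lra.
  by rewrite -mulrA ler_piMl ?mulr_ge0//; lra.
have [D3|nD3] := boolP (domD3 alpha gamma).
  apply: Or33; have /andP[c0 c1] : 0 < c < 1 by apply: hc2; rewrite D3 orbT.
  have /and5P[a0 a1 g0 g1 _] := D3.
  split; rewrite /kappa1 /kappa2 ?(negPf nD1) ?(negPf nD2) ?D3 ?a0 ?g0//=.
  rewrite ler_pM2r ?invr_gt0; last by lra.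
  by rewrite -mulrA ler_piMl ?mulr_ge0//; lra.
have D4 : domD4 alpha gamma.
  by move: hD; rewrite (negPf nD1) (negPf nD2) (negPf nD3).
apply: Or33; have /and3P[a0 /eqP e g1] := D4.
split; rewrite /kappa1 /kappa2 ?(negPf nD1) ?(negPf nD2) ?(negPf nD3) ?D4//=.
- by apply/andP; split; lra.
- by apply/andP; split; lra.
by rewrite -e le_eqVlt; apply/orP; left; apply/eqP; field; lra.
Qed.

(** The constants [kappa1] and [kappa2] are what completing the square yields in
    the decrement of the Lyapunov function.  For [gamma < 1] the form is already
    positive definite, and [kappa2] is at most its Schur complement with respect
    to [r].  For [gamma >= 1] the cross term [r.d] is first replaced through the
    consecutive-step inequality: wholly when [gamma > 1], which leaves [d.s] to
    be absorbed by a telescoping multiple [tau] of [|r|^2]; by one half when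
    [gamma = 1], which keeps a positive definite form in [(r, d)]. *)
Lemma stepsize_gap {R : realType} (alpha gamma c : R) :
  domD alpha gamma -> admissible_c alpha gamma c ->
  exists tau eps theta : R, [/\ 0 <= tau, 0 < eps &
  forall m (r d s : 'cV[R]_m) (Z : R),
    (1 + alpha) * dot r d <= alpha * dot d d + (1 - gamma) * dot d s + Z ->
    kappa2 alpha gamma c * dot d d + eps * dot (r - theta *: d) (r - theta *: d)
      + tau * (dot r r - dot s s) - kappa1 alpha gamma * Z
    <= (2 - alpha - gamma) * dot r r - 2 * (1 - alpha) * dot r d
       + (1 - alpha) * dot d d].
Proof.
move=> hD hc; case: (domD_case hD hc) => [[[/andP[a0 a1] g1 g2] /andP[c0 c1] cB]
  |[/andP[a0 a1] -> ]|[/andP[a0 a1] /andP[g0 g1]]].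
- move=> -> ->; have p0 : 0 < (1 - c) * (1 + alpha) by apply: mulr_gt0; lra.
  set tau := (gamma - 1) ^+ 2 / ((1 - c) * (1 + alpha)).
  have tau2 : tau < 2 - alpha - gamma by rewrite ltr_pdivrMr//; nra.
  (* [tau] is the least weight of [|s|^2] that absorbs [d.s] by means of the
     share [1 - c] of [|d|^2]; by the bound on [c] it is less than the weight
     of [|r|^2] *)
  exists tau, (2 - alpha - gamma - tau), 0; split.
  + by rewrite divr_ge0 ?sqr_ge0 ?ltW.
  + by lra.
  move=> m r d s Z hZ; rewrite scale0r subr0.
  set w := ((1 - c) * (1 - alpha)) *: d + (gamma - 1) *: s.
  have : 0 <= ((1 - c) * (1 + alpha))^-1 * dot w w.
    by rewrite mulr_ge0 ?dot_ge0// invr_ge0 ltW.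
  have -> : ((1 - c) * (1 + alpha))^-1 * dot w w
    = (1 - c) * (1 - alpha) ^+ 2 / (1 + alpha) * dot d d
      + 2 * (1 - alpha) * (gamma - 1) / (1 + alpha) * dot d s + tau * dot s s.
    rewrite /w /tau !dot_lin (dotC s d); field.
    by apply/andP; split; lra.
  move=> hw; have k0 : 0 <= 2 * (1 - alpha) / (1 + alpha).
    by rewrite divr_ge0//; lra.
  have := ler_wpM2l k0 hZ; rewrite mulrA divfK; last by lra.
  move=> {}hZ; rewrite -subr_ge0; move: hZ; rewrite -subr_ge0 => hZ.
  move: (addr_ge0 hw hZ); congr (0 <= _).
  by field; lra.
- move=> -> k2; exists 0, (1 - alpha), 2^-1; split=> //; first by lra.
  move=> m r d s Z; rewrite subrr mul0r addr0 => hZ.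
  have k0 : 0 <= (1 - alpha) / (1 + alpha) by rewrite divr_ge0//; lra.
  have := ler_wpM2l k0 hZ; rewrite mulrA divfK; last by lra.
  move=> {}hZ; have := ler_wpM2r (dot_ge0 d) k2; rewrite -subr_ge0 => k2d.
  rewrite -subr_ge0; move: hZ; rewrite -subr_ge0 => hZ.
  move: (addr_ge0 k2d hZ); congr (0 <= _); rewrite !dot_lin (dotC d r).
  by field; lra.
- move=> -> k2; have g2 : 0 < 2 - alpha - gamma by lra.
  exists 0, (2 - alpha - gamma), ((1 - alpha) / (2 - alpha - gamma)).
  split=> // m r d s Z _; have := ler_wpM2r (dot_ge0 d) k2.
  rewrite -subr_ge0 => k2d; rewrite -subr_ge0.
  move: k2d; congr (0 <= _).
  rewrite !dot_lin (dotC d r); field.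
  by lra.
Qed.

(** * Limits of vectors and coercivity of definite forms *)

Section VectorLimits.
Context {R : realType} {I : Type} (F : set_system I) {FF : Filter F}.

Lemma cvg_colP {n} (u : I -> 'cV[R]_n) (l : 'cV[R]_n) :
  (forall i, u k i 0 @[k --> F] --> l i 0) <-> u @ F --> l.
Proof.
split=> [ul|ul i]; last exact: cvg_comp ul (@coord_continuous _ _ _ i 0 l).
move=> B [P Pl PB]; apply: (@filterS _ F _ [set k | forall i, P i 0 (u k i 0)]).
  by move=> k Pk; apply: PB => i j; rewrite (ord1 j).
by apply: filter_forall => i; apply: ul; apply: Pl.
Qed.

Lemma cvg_sum_ord {n} (u : 'I_n -> I -> R) (l : 'I_n -> R) :
  (forall i, u i k @[k --> F] --> l i) ->
  \sum_i u i k @[k --> F] --> \sum_i l i.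
Proof. by move=> ul; apply: cvg_big => //; exact: add_continuous. Qed.

Lemma cvg_dot {n} (u v : I -> 'cV[R]_n) (a b : 'cV[R]_n) :
  u @ F --> a -> v @ F --> b -> dot (u k) (v k) @[k --> F] --> dot a b.
Proof.
move=> /cvg_colP ua /cvg_colP vb; rewrite dotE.
under eq_cvg do rewrite dotE.
by apply: cvg_sum_ord => i; apply: cvgM.
Qed.

Lemma cvg_mulmx {m n} (A : 'M[R]_(m, n)) (u : I -> 'cV[R]_n) (a : 'cV[R]_n) :
  u @ F --> a -> A *m u k @[k --> F] --> A *m a.
Proof.
move=> /cvg_colP ua; apply/cvg_colP => i; rewrite mxE.
under eq_cvg do rewrite mxE.
by apply: cvg_sum_ord => j; apply: cvgMl_tmp; apply: ua.
Qed.

Lemma cvg_qform {n} (G : 'M[R]_n) (u : I -> 'cV[R]_n) (a : 'cV[R]_n) :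
  u @ F --> a -> qform G (u k) @[k --> F] --> qform G a.
Proof.
move=> ua; rewrite qformE; under eq_cvg do rewrite qformE.
by apply: cvg_dot => //; apply: cvg_mulmx.
Qed.

Lemma cvg_dot0 {n} (u : I -> 'cV[R]_n) :
  dot (u k) (u k) @[k --> F] --> 0 -> u @ F --> (0 : 'cV[R]_n).
Proof.
move=> u0; apply/cvg_colP => i; rewrite mxE.
apply/cvgr0Pnorm_lt => e e0.
have e2 : 0 < e ^+ 2 by rewrite exprn_gt0.
have := u0; move=> /cvgr0Pnorm_lt /(_ _ e2); apply: filterS => k.
rewrite ger0_norm ?dot_ge0// => /(le_lt_trans (sqr_entry_le_dot _ i)).
by rewrite -real_normK ?num_real// ltr_pXn2r// nnegrE ltW.
Qed.

Lemma cvgD0 {n} (u v : I -> 'cV[R]_n) (l : 'cV[R]_n) : u @ F --> l ->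
  v @ F --> (0 : 'cV[R]_n) -> u k + v k @[k --> F] --> l.
Proof. by move=> ul v0; rewrite -[l]addr0; exact: cvgD. Qed.

Lemma cvgB0 {n} (u v : I -> 'cV[R]_n) (l : 'cV[R]_n) : u @ F --> l ->
  v @ F --> (0 : 'cV[R]_n) -> u k - v k @[k --> F] --> l.
Proof. by move=> ul v0; rewrite -[l]subr0; exact: cvgB. Qed.

Lemma cvg_scale0 {n} {a : R} (v : I -> 'cV[R]_n) :
  v @ F --> (0 : 'cV[R]_n) -> a *: v k @[k --> F] --> (0 : 'cV[R]_n).
Proof. by move=> v0; rewrite -(scaler0 _ a); exact: cvgZl_tmp. Qed.

Lemma cvg_mulmx0 {m n} {A : 'M[R]_(m, n)} (v : I -> 'cV[R]_n) :
  v @ F --> (0 : 'cV[R]_n) -> A *m v k @[k --> F] --> (0 : 'cV[R]_m).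
Proof. by move=> v0; rewrite -(mulmx0 _ A); exact: cvg_mulmx. Qed.

Lemma cvg_mul0 {a : R} (v : I -> R) :
  v @ F --> 0 -> a * v k @[k --> F] --> 0.
Proof. by move=> v0; rewrite -(mulr0 a); exact: cvgMl_tmp. Qed.

Lemma cvg_add0 (u v : I -> R) :
  u @ F --> 0 -> v @ F --> 0 -> u k + v k @[k --> F] --> 0.
Proof. by move=> u0 v0; rewrite -(addr0 0); exact: cvgD. Qed.

Lemma cvg_dot00 {n} (v : I -> 'cV[R]_n) :
  v @ F --> (0 : 'cV[R]_n) -> dot (v k) (v k) @[k --> F] --> 0.
Proof.
move=> v0; rewrite (_ : 0 = dot (0 : 'cV[R]_n) 0); first exact: cvg_dot.
by rewrite /dot mulmx0 mxE.
Qed.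

Lemma cvg_qform0 {n} {G : 'M[R]_n} (v : I -> 'cV[R]_n) :
  v @ F --> (0 : 'cV[R]_n) -> qform G (v k) @[k --> F] --> 0.
Proof.
move=> v0; rewrite (_ : 0 = qform G 0); first exact: cvg_qform.
by rewrite /qform mulmx0 mxE.
Qed.

End VectorLimits.

Lemma ultra_fmap {T U : Type} (f : T -> U) (F : set_system T) :
  UltraFilter F -> UltraFilter (f @ F).
Proof.
move=> FU; split; first exact: fmap_proper_filter.
move=> G GP FG; apply/seteqP; split=> [A GA|]; last exact: FG.
case: (in_ultra_setVsetC (f @^-1` A) FU) => // FA.
have GnA : G (~` A) by apply: FG.
by have [z []] := filter_ex (@filterI _ G _ _ _ GA GnA).
Qed.

(** Bolzano-Weierstrass in the form used here: passing to an ultrafilter instead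
    of a subsequence lets several bounded sequences converge at once. *)
Lemma bounded_ultra_cvg {R : realType} {I : Type} {n : nat} (F : set_system I)
    (u : I -> 'cV[R]_n) (C : R) :
  UltraFilter F -> (\forall k \near F, dot (u k) (u k) <= C) ->
  exists l : 'cV[R]_n, u @ F --> l.
Proof.
move=> FU uC.
have cv i : exists a : R, u k i 0 @[k --> F] --> a.
  have Co := @segment_compact R (- (C + 1)) (C + 1).
  rewrite compact_ultra in Co.
  have [||a [_ ha]] := Co ((fun k => u k i 0) @ F); last by exists a.
    exact: ultra_fmap.
  apply: filterS uC => k uC /=; rewrite in_itv/= -ler_norml.
  have := le_trans (sqr_entry_le_dot _ i) uC.
  rewrite -real_normK ?num_real// => h.
  (* [|t| <= t^2 + 1] keeps the bound free of square roots *)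
  have := sqr_ge0 (`|u k i 0| - 1); have := normr_ge0 (u k i 0); nra.
have [a ha] := choice cv.
by exists (\col_i a i); apply/cvg_colP => i; rewrite mxE.
Qed.

(** Otherwise unit vectors with values of the form below [1/k] would
    have a unit limit at which the form is nonpositive. *)
Lemma pd_coercive {R : realType} {n : nat} (G : 'M[R]_n) : pd G ->
  exists2 a : R, 0 < a & forall z, a * dot z z <= qform G z.
Proof.
move=> [Gs Gp]; apply: contrapT => hn.
have un (k : nat) : exists z, dot z z = 1 /\ qform G z <= k.+1%:R^-1.
  apply: contrapT => nk; apply: hn; exists k.+1%:R^-1 => [|z].
    by rewrite invr_gt0.
  have [->|z0] := eqVneq z 0.
    by rewrite qformE !mulmx0 /dot mulmx0 !mxE mulr0.
  have zz : 0 < dot z z.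
    rewrite lt_neqAle dot_ge0 andbT eq_sym.
    by apply: contra_neq z0; apply: dot_eq0.
  set s := (Num.sqrt (dot z z))^-1.
  have ss : s * s * dot z z = 1.
    by rewrite -expr2 exprVn sqr_sqrtr ?dot_ge0// mulVf// gt_eqF.
  rewrite leNgt; apply/negP => lt; apply: nk; exists (s *: z).
  rewrite qformE -scalemxAr !dot_lin -qformE !mulrA ss; split=> //.
  rewrite -[leRHS]mulr1 -[X in _ <= _ * X]ss mulrCA.
  by apply: ler_wpM2l; rewrite -?expr2 ?sqr_ge0 ?ltW.
have [u hu] := choice un.
have [U [UU sU]] := ultraFilterLemma (@eventually_filter).
have [l ul] : exists l : 'cV[R]_n, u @ U --> l.
  by apply: (bounded_ultra_cvg (C := 1)); apply: nearW => k; rewrite (hu k).1.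
have l1 : dot l l = 1.
  have u1 : dot (u k) (u k) @[k --> U] --> (1 : R).
    by under eq_cvg do rewrite (hu _).1; exact: cvg_cst.
  exact: (cvg_unique _ (cvg_dot ul ul) u1).
have : qform G l <= 0.
  have hh : (harmonic : nat -> R) @ U --> (0 : R).
    by apply: cvg_trans (@cvg_harmonic R); move=> A /sU.
  apply: ler_cvg_to (cvg_qform (G := G) ul) hh _; apply: nearW => k.
  exact: (hu k).2.
rewrite leNgt Gp//; apply: contra_eq_neq l1 => ->.
by rewrite /dot mulmx0 mxE eq_sym oner_neq0.
Qed.

Lemma pd_ge0 {R : realType} {n : nat} (G : 'M[R]_n) z : pd G -> 0 <= qform G z.
Proof.
case/pd_coercive => a a0 aG; apply: le_trans (aG z).
by rewrite mulr_ge0 ?dot_ge0 ?ltW.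
Qed.

Section DefiniteLimits.
Context {R : realType} {n : nat} {I : Type} (F : set_system I).
Variables (G : 'M[R]_n) (u : I -> 'cV[R]_n).
Hypothesis hG : pd G.

Lemma pd_cvg0 {FF : Filter F} (v : I -> R) :
  (forall k, qform G (u k) <= v k) -> v @ F --> 0 -> u @ F --> (0 : 'cV[R]_n).
Proof.
have [a a0 aG] := pd_coercive hG; move=> Gv v0; apply: cvg_dot0.
apply: squeeze_cvgr (cvg_cst 0) (cvg_mul0 (a := a^-1) v0); apply: nearW => k.
by rewrite /= dot_ge0 ler_pdivlMl// (le_trans (aG _)).
Qed.

Lemma pd_ultra_cvg (C : R) : UltraFilter F ->
  (\forall k \near F, qform G (u k) <= C) -> exists l : 'cV[R]_n, u @ F --> l.
Proof.
have [a a0 aG] := pd_coercive hG; move=> FU GC.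
apply: (bounded_ultra_cvg (C := a^-1 * C)); apply: filterS GC => k Gk.
by rewrite ler_pdivlMl// (le_trans (aG _)).
Qed.

End DefiniteLimits.

Lemma telescope_cvg0 {R : realType} (E D : nat -> R) : (forall k, 0 <= E k) ->
  (forall k, 0 <= D k) -> (forall k, E k.+1 + D k <= E k) -> D @ \oo --> 0.
Proof.
move=> E0 D0 ED.
have Ec : cvgn E.
  apply: nonincreasing_is_cvgn; last by exists 0 => _ [k _ <-].
  by apply/nonincreasing_seqP => k; have := ED k; have := D0 k; lra.
have d0 : E k - E k.+1 @[k --> \oo] --> 0.
  rewrite -(subrr (limn E)); apply: cvgB => //.
  by rewrite (cvg_shiftS E).
apply: squeeze_cvgr (cvg_cst 0) d0; apply: nearW => k.
by rewrite /= D0; have := ED k; lra.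
Qed.

(** * Subdifferentials *)

Section Subdifferentials.
Context {R : realType} {n : nat}.
Implicit Types (phi theta : 'cV[R]_n -> \bar R) (f : 'cV[R]_n -> R).

Lemma composite_proper phi f :
  proper_function phi -> proper_function (composite phi f).
Proof.
move=> [p1 [x0 p2]]; split=> [x|]; last exists x0; rewrite /composite.
  by have := p1 x; case: (phi x) => // r _; rewrite -EFinD ltNyr.
by move: p2; case: (phi x0) => // r _; rewrite -EFinD ltry.
Qed.

Lemma composite_convex phi f : proper_function phi -> convex_ereal phi ->
  convex_function [set: _] f -> convex_ereal (composite phi f).
Proof.
move=> [p1 _] cphi cf t x y t01; have /andP[t0 t1] := t01.
have [->|tn0] := eqVneq t 0.
  by rewrite scale0r add0r subr0 scale1r mul0e add0e mul1e.
have [->|tn1] := eqVneq t 1.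
  by rewrite scale1r subrr scale0r addr0 mul0e adde0 mul1e.
have tp : 0 < t by rewrite lt_neqAle eq_sym tn0.
have tq : 0 < 1 - t by rewrite subr_gt0 lt_neqAle tn1.
have hf : f (t *: x + (1 - t) *: y) <= t * f x + (1 - t) * f y.
  by have := cf (Itv01 t0 t1) x y; rewrite !inE => /(_ I I).
have toy : (t%:E * +oo = +oo)%E by rewrite gt0_muley ?lte_fin.
have qoy : ((1 - t)%:E * +oo = +oo)%E by rewrite gt0_muley ?lte_fin.
have := cphi t x y t01; rewrite /composite.
case: (phi x) (p1 x) => [rx||]// _; case: (phi y) (p1 y) => [ry||]// _;
  last 3 first.
- by move=> _; rewrite [(+oo + _)%E]addye// qoy addey ?leey// -EFinD -EFinM.
- by move=> _; rewrite [(+oo + _)%E]addye// toy addye ?leey// -EFinD -EFinM.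
- by move=> _; rewrite !addye// toy qoy addye ?leey.
case: (phi _) (p1 (t *: x + (1 - t) *: y)) => [rz||]// _.
rewrite -!EFinD !lee_fin.
by lra.
Qed.

Lemma subdifferential_fin theta x xi : proper_function theta ->
  subdifferential theta x xi -> theta x \is a fin_num.
Proof.
move=> [p1 [x0 p2]] /(_ x0); have := p1 x.
case: (theta x) => // _; rewrite addye// leye_eq => /eqP e.
by move: p2; rewrite e.
Qed.

(** First-order optimality for a convex function plus a quadratic that need not
    be convex: along the segment to [z] the quadratic part is of second order,
    so that a global minimizer behaves as in the convex case. *)
Lemma argmin_subdifferential theta f u grad (curv : 'cV[R]_n -> R) :
  proper_function theta -> convex_ereal theta ->
  (forall z t, f (u + t *: (z - u))
               = f u + t * dot grad (z - u) + t ^+ 2 * curv z) ->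
  argmin (fun z => theta z + (f z)%:E)%E u ->
  subdifferential theta u (- grad).
Proof.
move=> [p1 [x0 p2]] ct qf amin z.
have [a Eu] : exists a, theta u = a%:E.
  have := amin x0; have := p1 u; move: p2; case: (theta x0) => [v||]// _.
    by case: (theta u) => // a; exists a.
  by case: (theta u) => // a; exists a.
move: (p1 z); case E: (theta z) => [b||]// _; last by rewrite leey.
rewrite Eu dotNl -EFinD lee_fin.
have key t : 0 < t -> t <= 1 -> 0 <= b - a + dot grad (z - u) + t * curv z.
  move=> t0 t1; have t01 : 0 <= t <= 1 by rewrite ltW.
  have := ct t z u t01; rewrite E Eu -!EFinM -EFinD.
  have -> : t *: z + (1 - t) *: u = u + t *: (z - u).
    by rewrite scalerBr scalerBl scale1r addrCA.
  have := amin (u + t *: (z - u)); rewrite Eu qf.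
  have := p1 (u + t *: (z - u)); case: (theta _) => // r _.
  rewrite -!EFinD !lee_fin => h1 h2.
  by rewrite -(pmulr_rge0 _ t0); nra.
have [//|neg] := leP (a - dot grad (z - u)) b.
set e := a - dot grad (z - u) - b; have e0 : 0 < e by rewrite /e; lra.
have C0 := normr_ge0 (curv z); have Cl := ler_norm (curv z).
have D0 : 0 < 2 * (e + `|curv z|) by lra.
(* with this [t] the second-order term [t * curv z] stays below [e] *)
set t := e / (2 * (e + `|curv z|)).
have tp : 0 < t by rewrite divr_gt0.
have t1 : t <= 1 by rewrite ler_pdivrMr//; lra.
have tC : t * curv z < e.
  by rewrite /t -mulrA gtr_pMr// mulrC ltr_pdivrMr//; lra.
by have := key t tp t1; rewrite /e in tC *; lra.
Qed.

(** With [z] fixed, the subgradient inequality says that a point depending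
    continuously on [(u k, xi k)] lies in the epigraph of [phi]; the epigraph is
    closed. *)
Lemma subdifferential_closed phi f (I : Type) (F : set_system I)
    (FF : ProperFilter F) (u xi : I -> 'cV[R]_n) (u0 xi0 : 'cV[R]_n) :
  proper_function phi -> closed_function phi ->
  (forall x, differentiable f x) ->
  (forall k, subdifferential (composite phi f) (u k) (xi k)) ->
  u @ F --> u0 -> xi @ F --> xi0 ->
  subdifferential (composite phi f) u0 xi0.
Proof.
move=> pphi cphi df sub hu hxi z.
have [p1 _] := composite_proper f pphi.
move: (p1 z); case E: (composite phi f z) => [b||]// _; last by rewrite leey.
set rho := fun x xi => b - dot xi (z - x) - f x.
have epi k : (phi (u k) <= (rho (u k) (xi k))%:E)%E.
  have := sub k z; rewrite E /composite.
  have := pphi.1 (u k); case: (phi (u k)) => // r _; rewrite -!EFinD !lee_fin.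
  by rewrite /rho; lra.
have hrho : rho (u k) (xi k) @[k --> F] --> rho u0 xi0.
  rewrite /rho; apply: cvgB.
    apply: cvgB; first exact: cvg_cst.
    by apply: cvg_dot => //; apply: cvgB => //; exact: cvg_cst.
  by apply: continuous_cvg hu; exact: differentiable_continuous.
have lim : (phi u0 <= (rho u0 xi0)%:E)%E.
  apply: (@closed_cvg _ _ F FF (fun k => (u k, rho (u k) (xi k))) _ cphi
    (@filterE _ F _ _ epi) (u0, rho u0 xi0)).
  exact: cvg_pair hu hrho.
move: (pphi.1 u0) lim; rewrite /composite; case: (phi u0) => [r||]// _.
by rewrite -!EFinD !lee_fin /rho; lra.
Qed.

End Subdifferentials.

(** * Optimality conditions and descent along the iteration *)

(** Optimality of one subproblem in the form common to both blocks: [w] holds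
    the part of the residual that does not depend on the minimized variable. *)
Lemma proximal_optimality {R : realType} {m n : nat}
    (theta : 'cV[R]_n -> \bar R) (A : 'M[R]_(m, n)) (l w : 'cV[R]_m)
    (beta c0 : R) (S : 'M[R]_n)
    (u0 u : 'cV[R]_n) :
  proper_function theta -> convex_ereal theta -> S^T = S ->
  argmin (fun z => theta z + (c0 - dot l (A *m z + w)
            + beta / 2 * dot (A *m z + w) (A *m z + w)
            + 2^-1 * qform S (z - u0))%:E)%E u ->
  subdifferential theta u (A^T *m (l - beta *: (A *m u + w)) - S *m (u - u0)).
Proof.
move=> pt ct Ss /(argmin_subdifferential pt ct) opt.
rewrite -[X in subdifferential _ _ X]opprK opprB.
apply: (opt _ (fun z => beta / 2 * dot (A *m (z - u)) (A *m (z - u))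
                  + 2^-1 * qform S (z - u))) => z t.
have -> : A *m (u + t *: (z - u)) + w = (A *m u + w) + t *: (A *m (z - u)).
  by rewrite mulmxDr -scalemxAr addrAC.
have -> : u + t *: (z - u) - u0 = (u - u0) + t *: (z - u) by rewrite addrAC.
rewrite (qform_polar _ _ Ss) !qformE -!scalemxAr.
move: (z - u) (A *m u + w) (u - u0) => v r e.
rewrite !dot_lin (dot_mulmxl A^T) (dot_mulmxl S) Ss trmxK !dot_lin.
rewrite (dotC (A *m v) r).
by lra.
Qed.

Section Iteration.
Context {R : realType} {n1 n2 m : nat}.
Variables (theta1 : 'cV[R]_n1 -> \bar R) (theta2 : 'cV[R]_n2 -> \bar R).
Variables (A : 'M[R]_(m, n1)) (B : 'M[R]_(m, n2)) (b : 'cV[R]_m).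
Variables (Sigma1 S : 'M[R]_n1) (Sigma2 T Tplus Tminus : 'M[R]_n2).
Variables (beta alpha gamma : R).

Local Notation res := (residual A B b).

Definition half_multiplier (x : nat -> 'cV[R]_n1) (y : nat -> 'cV[R]_n2)
    (lambda : nat -> 'cV[R]_m) (k : nat) : 'cV[R]_m :=
  lambda k - (alpha * beta) *: res (x k.+1) (y k).

(** What the convergence analysis uses of the iteration: the first-order
    conditions of the subproblems in place of global minimality. *)
Definition optimality_sequence (x : nat -> 'cV[R]_n1) (y : nat -> 'cV[R]_n2)
    (lambda : nat -> 'cV[R]_m) : Prop :=
  forall k, [/\ subdifferential theta1 (x k.+1)
      (A^T *m (lambda k - beta *: res (x k.+1) (y k)) - S *m (x k.+1 - x k)),
    subdifferential theta2 (y k.+1)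
      (B^T *m (half_multiplier x y lambda k - beta *: res (x k.+1) (y k.+1))
       - T *m (y k.+1 - y k))
  & lambda k.+1 = half_multiplier x y lambda k
                  - (gamma * beta) *: res (x k.+1) (y k.+1)].

Lemma iPSPR_optimality_sequence x y lambda :
  proper_function theta1 -> convex_ereal theta1 ->
  proper_function theta2 -> convex_ereal theta2 -> S^T = S -> T^T = T ->
  iPSPR theta1 theta2 A B b beta alpha gamma S T x y lambda ->
  optimality_sequence x y lambda.
Proof.
move=> p1 c1 p2 c2 Ss Ts it k; have [ax ay al] := it k.
have sx : subdifferential theta1 (x k.+1)
    (A^T *m (lambda k - beta *: res (x k.+1) (y k)) - S *m (x k.+1 - x k)).
  rewrite /residual -addrA; apply: (proximal_optimality (c0 := 0)) => // z.
  have := ax z; rewrite /aug_lagrangian !adde0 /residual -!(addrA (A *m _)).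
  by rewrite -!addeA -!EFinD !add0r !addrA.
split=> //; have := subdifferential_fin p1 sx.
case E: (theta1 (x k.+1)) => [a||]// _.
have resE v : res (x k.+1) v = B *m v + (A *m x k.+1 - b).
  by rewrite /residual addrAC addrC.
rewrite /half_multiplier !resE.
apply: (proximal_optimality (c0 := a)) => // z.
have := ay z; rewrite /aug_lagrangian !resE E.
by rewrite !(addeC a%:E) -!addeA -!EFinD !addrA.
Qed.

(** The arguments are the errors of the three blocks with respect to an optimal
    triple. *)
Definition lyapunov (ex : 'cV[R]_n1) (ey : 'cV[R]_n2) (el : 'cV[R]_m) : R :=
  qform (S + Sigma1) ex + qform (T + Sigma2) ey
  + dual_energy beta alpha gamma (B *m ey) el.

Lemma lyapunov_step ex ey el ex' ey' eh el' :
  beta != 0 -> alpha + gamma != 0 -> S^T = S -> T^T = T ->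
  psd Sigma1 -> psd Sigma2 ->
  qform Sigma1 ex'
    <= dot ex' (A^T *m (el - beta *: (A *m ex' + B *m ey)) - S *m (ex' - ex)) ->
  eh = el - (alpha * beta) *: (A *m ex' + B *m ey) ->
  qform Sigma2 ey'
    <= dot ey' (B^T *m (eh - beta *: (A *m ex' + B *m ey'))
                - T *m (ey' - ey)) ->
  el' = eh - (gamma * beta) *: (A *m ex' + B *m ey') ->
  lyapunov ex' ey' el' + qform (S + 2^-1 *: Sigma1) (ex' - ex)
    + qform (T + 2^-1 *: Sigma2) (ey' - ey)
    + beta * ((2 - alpha - gamma)
                * dot (A *m ex' + B *m ey') (A *m ex' + B *m ey')
              - 2 * (1 - alpha)
                * dot (A *m ex' + B *m ey') (B *m (ey' - ey))
              + (1 - alpha) * dot (B *m (ey' - ey)) (B *m (ey' - ey)))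
  <= lyapunov ex ey el.
Proof.
move=> b0 ag0 Ss Ts p1 p2 hx Eh hy El.
have := dual_energy_step b0 ag0 Eh El.
have := prox_step_le Ss p1 hx; have := prox_step_le Ts p2 hy.
rewrite -!dot_mulmxl /lyapunov mulmxBr.
by lra.
Qed.

Hypotheses (hbeta : 0 < beta) (hag : 0 < alpha + gamma).
Hypotheses (hS : S^T = S) (hT : T^T = T).
Hypotheses (hTpm : T = Tplus - Tminus) (hTp : psd Tplus) (hTm : psd Tminus).
Hypotheses (hSigma1 : convexity_matrix theta1 Sigma1)
           (hSigma2 : convexity_matrix theta2 Sigma2).
Variables (x : nat -> 'cV[R]_n1) (y : nat -> 'cV[R]_n2)
          (lambda : nat -> 'cV[R]_m).
Hypothesis hopt : optimality_sequence x y lambda.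

(** The part of the change of the residual that is due to the second block. *)
Local Notation jump k := (B *m (y k.+1 - y k)).

Lemma residual_optimal w u v : optimal_set theta1 theta2 A B b w ->
  A *m (u - w.1.1) + B *m (v - w.1.2) = res u v.
Proof.
by case=> <- _ _; rewrite /residual !mulmxBr opprD addrACA.
Qed.

Lemma lyapunov_descent w k : optimal_set theta1 theta2 A B b w ->
  lyapunov (x k.+1 - w.1.1) (y k.+1 - w.1.2) (lambda k.+1 - w.2)
    + qform (S + 2^-1 *: Sigma1) (x k.+1 - x k)
    + qform (T + 2^-1 *: Sigma2) (y k.+1 - y k)
    + beta * ((2 - alpha - gamma)
                * dot (res (x k.+1) (y k.+1)) (res (x k.+1) (y k.+1))
              - 2 * (1 - alpha) * dot (res (x k.+1) (y k.+1)) (jump k)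
              + (1 - alpha) * dot (jump k) (jump k))
  <= lyapunov (x k - w.1.1) (y k - w.1.2) (lambda k - w.2).
Proof.
move=> wo; have rE := residual_optimal _ _ wo.
have [_ wx wy] := wo; have [kx ky kl] := hopt k.
have dB n (u v z : 'cV[R]_n) : u - v = (u - z) - (v - z).
  by rewrite opprB addrA addrNK.
rewrite -!rE (dB _ (x k.+1) (x k) w.1.1) (dB _ (y k.+1) (y k) w.1.2).
apply: (@lyapunov_step _ _ _ _ _ (half_multiplier x y lambda k - w.2));
  rewrite ?rE -?dB //; try exact: lt0r_neq0.
- exact: hSigma1.1.
- exact: hSigma2.1.
- have := hSigma1.2 _ _ _ _ kx wx.
  by rewrite addrAC -mulmxBr addrAC.
- by rewrite /half_multiplier addrAC.
- have := hSigma2.2 _ _ _ _ ky wy.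
  by rewrite addrAC -mulmxBr addrAC.
- by rewrite kl addrAC.
Qed.

(** Subtracting the optimality conditions of two consecutive [y]-steps
    eliminates the multiplier altogether. *)
Lemma consecutive_descent k :
  (1 + alpha) * dot (res (x k.+2) (y k.+2)) (jump k.+1)
  <= alpha * dot (jump k.+1) (jump k.+1)
     + (1 - gamma) * dot (jump k.+1) (res (x k.+1) (y k.+1))
     + beta^-1 * (2^-1 * (qform (Tplus + Tminus) (y k.+1 - y k)
                          - qform (Tplus + Tminus) (y k.+2 - y k.+1))
                  + 2 * qform Tminus (y k.+2 - y k.+1)
                  - qform Sigma2 (y k.+2 - y k.+1)).
Proof.
have [_ ky kl] := hopt k; have [_ ky' _] := hopt k.+1.
have := hSigma2.2 _ _ _ _ ky' ky.
set d := y k.+2 - y k.+1; set d' := y k.+1 - y k.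
set r := res (x k.+2) (y k.+2); set s := res (x k.+1) (y k.+1).
have hr : res (x k.+2) (y k.+1) = r - B *m d.
  rewrite /r /d /residual mulmxBr.
  move: (A *m _) (B *m y k.+1) (B *m y k.+2) => a v v'.
  by apply/matrixP => i j; rewrite !mxE; ring.
have hg : half_multiplier x y lambda k.+1 - beta *: r
            - (half_multiplier x y lambda k - beta *: s)
  = beta *: (alpha *: (B *m d) + (1 - gamma) *: s - (1 + alpha) *: r).
  rewrite {1}/half_multiplier hr kl -/s; move: (half_multiplier _ _ _ _) => h.
  move: r s (B *m d) {hr} => r s v.
  by apply/matrixP => i j; rewrite !mxE; ring.
have subrACA (u v u' v' : 'cV[R]_n2) : u - v - (u' - v') = u - u' - (v - v').
  by apply/matrixP => i j; rewrite !mxE; ring.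
rewrite subrACA -!mulmxBr hg; clear hg hr; clearbody d d' r s.
move=> /(consecutive_prox_steps hTpm hTp hTm).
rewrite -dot_mulmxl !dot_lin (dotC _ r) -subr_ge0 => h.
rewrite -(ler_pM2l hbeta) -subr_ge0; move: h.
congr (0 <= _); field.
exact: lt0r_neq0.
Qed.

(** * Convergence *)

Variable c : R.
Hypotheses (hD : domD alpha gamma) (hc : admissible_c alpha gamma c).

Local Notation gap_matrix :=
  (T + 2^-1 *: Sigma2 + kappa1 alpha gamma *: (- (2 *: Tminus) + Sigma2)
     + (kappa2 alpha gamma c * beta) *: (B^T *m B)).

(** The Lyapunov function augmented by the two telescoping terms produced by the
    treatment of the product of residual and jump. *)
Definition energy (tau : R) w (k : nat) : R :=
  lyapunov (x k.+1 - w.1.1) (y k.+1 - w.1.2) (lambda k.+1 - w.2)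
  + kappa1 alpha gamma / 2 * qform (Tplus + Tminus) (y k.+1 - y k)
  + tau * beta * dot (res (x k.+1) (y k.+1)) (res (x k.+1) (y k.+1)).

Definition decrement (eps theta : R) (k : nat) : R :=
  qform (S + 2^-1 *: Sigma1) (x k.+2 - x k.+1)
  + qform gap_matrix (y k.+2 - y k.+1)
  + beta * eps * dot (res (x k.+2) (y k.+2) - theta *: jump k.+1)
                     (res (x k.+2) (y k.+2) - theta *: jump k.+1).

(** The bound on the product of residual and jump enters with weight [kappa1]:
    its [Tminus] and [Sigma2] terms complete [T + Sigma2 / 2] to
    [gap_matrix], and its telescoping terms go into the energy. *)
Lemma energy_descent : exists tau eps theta : R, [/\ 0 <= tau, 0 < eps &
  forall w k, optimal_set theta1 theta2 A B b w ->
    energy tau w k.+1 + decrement eps theta k <= energy tau w k].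
Proof.
have [tau [eps [theta [tau0 eps0 gap]]]] := stepsize_gap hD hc.
exists tau, eps, theta; split=> // w k wo.
have scale z : beta * (kappa1 alpha gamma * (beta^-1 * z))
               = kappa1 alpha gamma * z.
  by field; exact: lt0r_neq0.
have := gap _ _ _ _ _ (consecutive_descent k).
rewrite -(ler_pM2l hbeta) [X in X <= _]mulrBr scale.
have := lyapunov_descent k.+1 wo.
rewrite /energy /decrement !(qformD, qformZ, qformN, qform_gram).
move: (dot (_ - theta *: _) _) => q.
by lra.
Qed.

Hypotheses (hS1 : psd (S + 2^-1 *: Sigma1))
  (hS2 : pd (S + 2^-1 *: Sigma1 + beta *: (A^T *m A)))
  (hT1 : pd (T + Sigma2 + ((1 - alpha) * beta) *: (B^T *m B)))
  (hT2 : pd gap_matrix).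

Lemma kappa1_ge0 : 0 <= kappa1 alpha gamma.
Proof.
case: (domD_case hD hc) => [[[/andP[a0 a1] _ _] _ _ -> _]|[/andP[a0 a1] _ -> _]
  |[_ _ -> _]] //; by rewrite divr_ge0//; lra.
Qed.

(** The Lyapunov function sees the error in [x] only through the semidefinite
    [S + Sigma1]; definiteness is recovered from the residual, which controls
    the image under [A]. *)
Lemma qform_x_le u :
  qform (S + 2^-1 *: Sigma1 + beta *: (A^T *m A)) u
  <= qform (S + Sigma1) u + beta * dot (A *m u) (A *m u).
Proof.
have := hSigma1.1.2 u; rewrite !(qformD, qformZ) qform_gram; lra.
Qed.

Lemma qform_x_ge0 u : 0 <= qform (S + Sigma1) u.
Proof.
have := hSigma1.1.2 u; have := hS1.2 u; rewrite !(qformD, qformZ); lra.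
Qed.

Lemma lyapunovE ex ey el : lyapunov ex ey el
  = qform (S + Sigma1) ex
    + qform (T + Sigma2 + ((1 - alpha) * beta) *: (B^T *m B)) ey
    + (beta * (alpha + gamma))^-1
      * dot (el - (alpha * beta) *: (B *m ey))
            (el - (alpha * beta) *: (B *m ey)).
Proof.
rewrite /lyapunov /dual_energy (qformD (T + Sigma2)) qformZ qform_gram.
by rewrite !addrA.
Qed.

Lemma lyapunov_bounds ex ey el :
  [/\ qform (S + Sigma1) ex <= lyapunov ex ey el,
      qform (T + Sigma2 + ((1 - alpha) * beta) *: (B^T *m B)) ey
        <= lyapunov ex ey el,
      dot (el - (alpha * beta) *: (B *m ey)) (el - (alpha * beta) *: (B *m ey))
        <= beta * (alpha + gamma) * lyapunov ex ey el
    & 0 <= lyapunov ex ey el].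
Proof.
have h1 := qform_x_ge0 ex; have h2 := pd_ge0 ey hT1.
have bag : 0 < beta * (alpha + gamma) by rewrite mulr_gt0.
rewrite lyapunovE; set mu := el - _; have h3 := dot_ge0 mu.
have h4 : 0 <= (beta * (alpha + gamma))^-1 * dot mu mu.
  by rewrite mulr_ge0// invr_ge0 ltW.
split; try lra.
by rewrite mulrDr mulVKf ?lt0r_neq0// lerDr mulr_ge0 ?addr_ge0// ltW.
Qed.

Lemma energy_ge0 tau w k : 0 <= tau -> lyapunov (x k.+1 - w.1.1)
    (y k.+1 - w.1.2) (lambda k.+1 - w.2) <= energy tau w k.
Proof.
move=> tau0; rewrite /energy -addrA lerDl addr_ge0//.
  rewrite mulr_ge0 ?divr_ge0 ?kappa1_ge0// qformD addr_ge0//.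
    exact: hTp.2.
  exact: hTm.2.
by rewrite mulr_ge0 ?dot_ge0// mulr_ge0// ltW.
Qed.

Lemma decrement_terms_ge0 eps theta k : 0 < eps ->
  [/\ 0 <= qform (S + 2^-1 *: Sigma1) (x k.+2 - x k.+1)
        <= decrement eps theta k,
      qform gap_matrix (y k.+2 - y k.+1) <= decrement eps theta k,
      0 <= dot (res (x k.+2) (y k.+2) - theta *: jump k.+1)
          (res (x k.+2) (y k.+2) - theta *: jump k.+1)
        <= (beta * eps)^-1 * decrement eps theta k
    & 0 <= decrement eps theta k].
Proof.
move=> eps0; have be : 0 < beta * eps by rewrite mulr_gt0.
have h1 := hS1.2 (x k.+2 - x k.+1); have h2 := pd_ge0 (y k.+2 - y k.+1) hT2.
rewrite /decrement; set q := dot _ _; have h3 : 0 <= q := dot_ge0 _.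
have h4 : 0 <= beta * eps * q by rewrite mulr_ge0// ltW.
rewrite ler_pdivlMl// h1 h3; split => //; lra.
Qed.

Let dx k := x k.+2 - x k.+1.
Let dy k := y k.+2 - y k.+1.
Let r k := res (x k.+1) (y k.+1).

(** Consecutive iterates approach each other and the constraint is satisfied in
    the limit, since the decrements of the energy are summable. *)
Lemma asymptotic_regularity : optimal_set theta1 theta2 A B b !=set0 ->
  [/\ dx @ \oo --> (0 : 'cV[R]_n1), dy @ \oo --> (0 : 'cV[R]_n2)
    & r @ \oo --> (0 : 'cV[R]_m)].
Proof.
move=> [w wo]; have [tau [eps [theta [tau0 eps0 desc]]]] := energy_descent.
have D0 : decrement eps theta @ \oo --> 0.
  apply: (telescope_cvg0 (E := energy tau w)) => k.
  - by have [_ _ _] := lyapunov_bounds (x k.+1 - w.1.1) (y k.+1 - w.1.2)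
      (lambda k.+1 - w.2); move/le_trans; apply; exact: energy_ge0.
  - by have [] := decrement_terms_ge0 theta k eps0.
  - exact: desc.
have dy0 : dy @ \oo --> (0 : 'cV[R]_n2).
  apply: (pd_cvg0 hT2 _ D0) => k.
  by have [] := decrement_terms_ge0 theta k eps0.
have jump0 : B *m dy k @[k --> \oo] --> (0 : 'cV[R]_m).
  exact: cvg_mulmx0.
have r0 : r @ \oo --> (0 : 'cV[R]_m).
  have q0 : r k.+1 - theta *: (B *m dy k) @[k --> \oo] --> (0 : 'cV[R]_m).
    apply: cvg_dot0.
    apply: squeeze_cvgr (cvg_cst 0) (cvg_mul0 (a := (beta * eps)^-1) D0).
    apply: nearW => k.
    by have [] := decrement_terms_ge0 theta k eps0.
  rewrite -(cvg_shiftS r).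
  have -> : (fun k => r k.+1)
      = (fun k => (r k.+1 - theta *: (B *m dy k)) + theta *: (B *m dy k)).
    by apply/funext => k; rewrite subrK.
  exact: cvgD0 q0 (cvg_scale0 jump0).
split=> //.
have Adx k : A *m dx k = r k.+1 - r k - B *m dy k.
  rewrite /dx /dy /r /residual !mulmxBr.
  move: (A *m x k.+2) (A *m x k.+1) (B *m y k.+2) (B *m y k.+1) => a a' v v'.
  by apply/matrixP => i j; rewrite !mxE; ring.
have Adx0 : A *m dx k @[k --> \oo] --> (0 : 'cV[R]_m).
  under eq_cvg do rewrite Adx.
  have r1 : r k.+1 @[k --> \oo] --> (0 : 'cV[R]_m) by rewrite (cvg_shiftS r).
  exact: cvgB0 (cvgB0 r1 r0) jump0.
apply: (pd_cvg0 hS2 (v := fun k => decrement eps theta k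
                           + beta * dot (A *m dx k) (A *m dx k))).
  move=> k; rewrite qformD qformZ qform_gram lerD2r.
  by have [/andP[]] := decrement_terms_ge0 theta k eps0.
exact: cvg_add0 D0 (cvg_mul0 (cvg_dot00 Adx0)).
Qed.

Definition closed_subdifferential n (theta : 'cV[R]_n -> \bar R) : Prop :=
  forall (F : set_system nat) (u xi : nat -> 'cV[R]_n) (u0 xi0 : 'cV[R]_n),
    ProperFilter F -> (forall k, subdifferential theta (u k) (xi k)) ->
    u @ F --> u0 -> xi @ F --> xi0 -> subdifferential theta u0 xi0.

Hypotheses (hclosed1 : closed_subdifferential theta1)
  (hclosed2 : closed_subdifferential theta2).
Hypothesis hne : optimal_set theta1 theta2 A B b !=set0.

(** The residual that enters the half multiplier, shifted by one step in line
    with [dx] and [dy]. *)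
Let q k := res (x k.+2) (y k.+1).

Let qE k : q k = r k.+1 - B *m dy k.
Proof.
rewrite /q /r /dy /residual !mulmxBr.
by move: (A *m _) (B *m _) (B *m _) => a v v'; apply/matrixP => i j;
  rewrite !mxE; ring.
Qed.

Let rS0 : r k.+1 @[k --> \oo] --> (0 : 'cV[R]_m).
Proof.
by have [_ _ r0] := asymptotic_regularity hne; rewrite (cvg_shiftS r).
Qed.

Let q0 : q @ \oo --> (0 : 'cV[R]_m).
Proof.
have [_ dy0 _] := asymptotic_regularity hne.
rewrite (_ : q = fun k => r k.+1 - B *m dy k); last exact/funext/qE.
exact: cvgB0 rS0 (cvg_mulmx0 dy0).
Qed.

(** A common limit of the iterates along a filter finer than the cofinite one is
    optimal: all perturbations in the optimality conditions vanish. *)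
Lemma ultra_limit_optimal (U : set_system nat) (FU : ProperFilter U) xb yb lb :
  \oo `<=` U ->
  x k.+1 @[k --> U] --> xb -> y k.+1 @[k --> U] --> yb ->
  lambda k.+1 @[k --> U] --> lb ->
  [/\ x k.+2 @[k --> U] --> xb, y k.+2 @[k --> U] --> yb,
      lambda k.+2 @[k --> U] --> lb
    & optimal_set theta1 theta2 A B b (xb, yb, lb)].
Proof.
move=> sU cx cy cl.
have toU (V : topologicalType) (u : nat -> V) (l : V) :
    u @ \oo --> l -> u @ U --> l.
  by move=> ul P Pl; apply: sU; exact: ul.
have [dx0 dy0 r0] := asymptotic_regularity hne.
have {}dx0 := toU _ _ _ dx0; have {}dy0 := toU _ _ _ dy0.
have rU := toU _ _ _ rS0; have qU := toU _ _ _ q0.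
have cx' : x k.+2 @[k --> U] --> xb.
  rewrite (_ : (fun k => x k.+2) = (fun k => x k.+1 + dx k)).
    exact: cvgD0 cx dx0.
  by apply/funext => k; rewrite /dx addrC subrK.
have cy' : y k.+2 @[k --> U] --> yb.
  rewrite (_ : (fun k => y k.+2) = (fun k => y k.+1 + dy k)).
    exact: cvgD0 cy dy0.
  by apply/funext => k; rewrite /dy addrC subrK.
have ch : half_multiplier x y lambda k.+1 @[k --> U] --> lb.
  exact: cvgB0 cl (cvg_scale0 qU).
have cl' : lambda k.+2 @[k --> U] --> lb.
  rewrite (_ : (fun k => lambda k.+2) = (fun k =>
    half_multiplier x y lambda k.+1 - (gamma * beta) *: r k.+1)).
    exact: cvgB0 ch (cvg_scale0 rU).
  by apply/funext => k; have [] := hopt k.+1.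
split=> //; split => /=.
- have s : r k.+1 @[k --> U] --> A *m xb + B *m yb - b.
    apply: cvgB (cvg_cst b).
    by apply: cvgD; exact: cvg_mulmx.
  apply/eqP; rewrite -subr_eq0; apply/eqP.
  exact: (cvg_unique _ s rU).
- apply: (hclosed1 (F := U) (u := fun k => x k.+2)
    (xi := fun k => A^T *m (lambda k.+1 - beta *: q k) - S *m dx k)) _ cx' _.
    by move=> k; have [] := hopt k.+1.
  exact: cvgB0 (cvg_mulmx (cvgB0 cl (cvg_scale0 qU))) (cvg_mulmx0 dx0).
- apply: (hclosed2 (F := U) (u := fun k => y k.+2)
    (xi := fun k => B^T *m (half_multiplier x y lambda k.+1 - beta *: r k.+1)
                    - T *m dy k)) _ cy' _.
    by move=> k; have [] := hopt k.+1.
  exact: cvgB0 (cvg_mulmx (cvgB0 ch (cvg_scale0 rU))) (cvg_mulmx0 dy0).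
Qed.

Lemma energy_nonincreasing tau eps theta w : 0 < eps ->
  (forall k, energy tau w k.+1 + decrement eps theta k <= energy tau w k) ->
  {homo energy tau w : i j / (i <= j)%N >-> j <= i}.
Proof.
move=> eps0 desc; apply/nonincreasing_seqP => k; have := desc k.
by have [_ _ _] := decrement_terms_ge0 theta k eps0; lra.
Qed.

(** The energy bounds the error in [y] and the shifted multiplier [mu].  As the
    residual vanishes, [A x] then converges along the ultrafilter, and this
    completes the semidefinite bound on the error in [x]. *)
Lemma exists_ultra_limit : exists (U : set_system nat) xb yb lb,
  [/\ UltraFilter U, \oo `<=` U, x k.+1 @[k --> U] --> (xb : 'cV[R]_n1),
      y k.+1 @[k --> U] --> (yb : 'cV[R]_n2)
    & lambda k.+1 @[k --> U] --> (lb : 'cV[R]_m)].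
Proof.
have [w wo] := hne.
have [tau [eps [theta [tau0 eps0 /(_ w _ wo) desc]]]] := energy_descent.
have lyC k : lyapunov (x k.+1 - w.1.1) (y k.+1 - w.1.2) (lambda k.+1 - w.2)
    <= energy tau w 0.
  apply: le_trans (energy_ge0 _ _ tau0) _.
  exact: energy_nonincreasing eps0 desc _ _ (leq0n k).
have [U [UU sU]] := ultraFilterLemma (@eventually_filter).
have [ly cy] : exists l : 'cV[R]_n2, y k.+1 - w.1.2 @[k --> U] --> l.
  apply: (pd_ultra_cvg hT1 (C := energy tau w 0)); apply: nearW => k.
  by apply: le_trans (lyC k); have [] := lyapunov_bounds (x k.+1 - w.1.1)
    (y k.+1 - w.1.2) (lambda k.+1 - w.2).
pose mu k := lambda k.+1 - w.2 - (alpha * beta) *: (B *m (y k.+1 - w.1.2)).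
have [lm cm] : exists l : 'cV[R]_m, mu @ U --> l.
  apply: (bounded_ultra_cvg (C := beta * (alpha + gamma) * energy tau w 0)).
  apply: nearW => k; have [_ _ h _] := lyapunov_bounds (x k.+1 - w.1.1)
    (y k.+1 - w.1.2) (lambda k.+1 - w.2).
  by apply: le_trans h _; rewrite ler_wpM2l// mulr_ge0 ?ltW.
have [_ _ r0] := asymptotic_regularity hne.
have rU : r @ U --> (0 : 'cV[R]_m) by move=> P Pl; apply: sU; exact: r0.
have cAx : A *m (x k.+1 - w.1.1) @[k --> U] --> (0 - B *m ly : 'cV[R]_m).
  rewrite (_ : (fun k => _) = (fun k => r k - B *m (y k.+1 - w.1.2))).
    exact: cvgB rU (cvg_mulmx cy).
  by apply/funext => k; rewrite /r -(residual_optimal _ _ wo) addrK.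
set a := 0 - B *m ly in cAx.
have [lx cx] : exists l : 'cV[R]_n1, x k.+1 - w.1.1 @[k --> U] --> l.
  apply: (pd_ultra_cvg hS2 (C := energy tau w 0 + beta * (dot a a + 1))).
  have nA : \forall k \near U,
      dot (A *m (x k.+1 - w.1.1)) (A *m (x k.+1 - w.1.1)) <= dot a a + 1.
    by apply: cvgr_le (cvg_dot cAx cAx) _ _; rewrite ltrDl.
  apply: filterS nA => k hk.
  apply: le_trans (qform_x_le _) _; rewrite lerD//; last by rewrite ler_pM2l.
  by apply: le_trans (lyC k); have [] := lyapunov_bounds (x k.+1 - w.1.1)
    (y k.+1 - w.1.2) (lambda k.+1 - w.2).
exists U, (lx + w.1.1), (ly + w.1.2),
  (lm + (alpha * beta) *: (B *m ly) + w.2).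
split; [exact: UU|exact: sU| | |].
- rewrite (_ : (fun k => x k.+1) = (fun k => x k.+1 - w.1.1 + w.1.1)).
    exact: cvgD cx (cvg_cst _).
  by apply/funext => k; rewrite subrK.
- rewrite (_ : (fun k => y k.+1) = (fun k => y k.+1 - w.1.2 + w.1.2)).
    exact: cvgD cy (cvg_cst _).
  by apply/funext => k; rewrite subrK.
- rewrite (_ : (fun k => lambda k.+1) = (fun k => mu k
    + (alpha * beta) *: (B *m (y k.+1 - w.1.2)) + w.2)).
    apply: cvgD (cvg_cst _); apply: cvgD cm _.
    exact: cvgZl_tmp (cvg_mulmx cy).
  by apply/funext => k; rewrite /mu !subrK.
Qed.

(** The energy with respect to the limit [w] tends to zero along the
    ultrafilter; being nonincreasing, it tends to zero along the whole
    sequence. *)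
Lemma energy_cvg0 tau eps theta w (U : set_system nat) :
  0 <= tau -> 0 < eps -> ProperFilter U -> \oo `<=` U ->
  (forall k, energy tau w k.+1 + decrement eps theta k <= energy tau w k) ->
  x k.+2 @[k --> U] --> w.1.1 -> y k.+2 @[k --> U] --> w.1.2 ->
  lambda k.+2 @[k --> U] --> w.2 ->
  energy tau w @ \oo --> 0.
Proof.
move=> tau0 eps0 UP sU desc cx cy cl.
have [_ dy0 _] := asymptotic_regularity hne.
have EU : energy tau w k.+1 @[k --> U] --> 0.
  have dyU : dy @ U --> (0 : 'cV[R]_n2) by move=> P Pl; apply: sU; exact: dy0.
  have rU : r k.+1 @[k --> U] --> (0 : 'cV[R]_m).
    by move=> P Pl; apply: sU; exact: rS0.
  move: cx cy cl => /subr_cvg0 ex0 /subr_cvg0 ey0 /subr_cvg0 el0.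
  have eB0 : B *m (y k.+2 - w.1.2) @[k --> U] --> (0 : 'cV[R]_m).
    exact: cvg_mulmx0.
  rewrite /energy /lyapunov /dual_energy.
  apply: cvg_add0 (cvg_mul0 (cvg_dot00 rU)).
  apply: cvg_add0 (cvg_mul0 (cvg_qform0 dyU)).
  apply: cvg_add0 (cvg_add0 (cvg_qform0 ex0) (cvg_qform0 ey0)) _.
  apply: cvg_add0 (cvg_mul0 (cvg_dot00 eB0)) _.
  apply: cvg_mul0; apply: cvg_dot00.
  exact: cvgB0 el0 (cvg_scale0 eB0).
apply/cvgr0Pnorm_lt => e e0.
have E0 k : 0 <= energy tau w k.
  by have [_ _ _] := lyapunov_bounds (x k.+1 - w.1.1) (y k.+1 - w.1.2)
    (lambda k.+1 - w.2); move/le_trans; apply; exact: energy_ge0.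
have [k hk] := filter_ex (cvgr_lt _ EU _ e0).
exists k.+1 => // j /= kj; rewrite ger0_norm//; apply: le_lt_trans hk.
exact: energy_nonincreasing eps0 desc _ _ kj.
Qed.

Lemma optimality_sequence_cvg :
  exists2 w, optimal_set theta1 theta2 A B b w
           & (x k, y k, lambda k) @[k --> \oo] --> w.
Proof.
have [U [xb [yb [lb [UU sU cx cy cl]]]]] := exists_ultra_limit.
have [cx' cy' cl' wo] := ultra_limit_optimal _ sU cx cy cl.
set w := (xb, yb, lb) in wo; exists w => //.
have [tau [eps [theta [tau0 eps0 /(_ w _ wo) desc]]]] := energy_descent.
have E0 : energy tau w @ \oo --> 0.
  exact: energy_cvg0 tau0 eps0 _ sU desc cx' cy' cl'.
have bounds k := lyapunov_bounds (x k.+1 - xb) (y k.+1 - yb) (lambda k.+1 - lb).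
have ly k : lyapunov (x k.+1 - xb) (y k.+1 - yb) (lambda k.+1 - lb)
    <= energy tau w k := energy_ge0 w k tau0.
have cey : y k.+1 - yb @[k --> \oo] --> (0 : 'cV[R]_n2).
  apply: (pd_cvg0 hT1 _ E0) => k; apply: le_trans (ly k).
  by have [] := bounds k.
have cB : B *m (y k.+1 - yb) @[k --> \oo] --> (0 : 'cV[R]_m).
  exact: cvg_mulmx0.
have cel : lambda k.+1 - lb @[k --> \oo] --> (0 : 'cV[R]_m).
  rewrite (_ : (fun k => lambda k.+1 - lb) = (fun k =>
    lambda k.+1 - lb - (alpha * beta) *: (B *m (y k.+1 - yb))
    + (alpha * beta) *: (B *m (y k.+1 - yb)))).
    apply: cvgD0 (cvg_scale0 cB); apply: cvg_dot0.
    apply: squeeze_cvgr (cvg_cst 0) (cvg_mul0 (a := beta * (alpha + gamma)) E0).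
    apply: nearW => k; rewrite /= dot_ge0; have [_ _ h _] := bounds k.
    by apply: le_trans h _; rewrite ler_wpM2l ?ly// mulr_ge0 ?ltW.
  by apply/funext => k; rewrite subrK.
have [_ _ r0] := asymptotic_regularity hne.
have cAx : A *m (x k.+1 - xb) @[k --> \oo] --> (0 : 'cV[R]_m).
  rewrite (_ : (fun k => _) = (fun k => r k - B *m (y k.+1 - yb))).
    exact: cvgB0 r0 cB.
  by apply/funext => k; rewrite /r -(residual_optimal _ _ wo) addrK.
have cex : x k.+1 - xb @[k --> \oo] --> (0 : 'cV[R]_n1).
  apply: (pd_cvg0 hS2 _ (cvg_add0 E0 (cvg_mul0 (a := beta) (cvg_dot00 cAx)))).
  move=> k; apply: le_trans (qform_x_le _) _.
  by rewrite lerD2r; apply: le_trans (ly k); have [] := bounds k.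
have unshift n (u : nat -> 'cV[R]_n) (l : 'cV[R]_n) :
    u k.+1 - l @[k --> \oo] --> (0 : 'cV[R]_n) -> u @ \oo --> l.
  by move=> /subr_cvg0; rewrite (cvg_shiftS u).
have cx0 := unshift _ _ _ cex; have cy0 := unshift _ _ _ cey.
exact: cvg_pair (cvg_pair cx0 cy0) (unshift _ _ _ cel).
Qed.

End Iteration.

Theorem theorem3p2 (R : realType) (n1 n2 m : nat)
    (A : 'M[R]_(m, n1)) (B : 'M[R]_(m, n2)) (b : 'cV[R]_m)
    (p : 'cV[R]_n1 -> \bar R) (f : 'cV[R]_n1 -> R)
    (h : 'cV[R]_n2 -> \bar R) (g : 'cV[R]_n2 -> R)
    (Sigma1 S : 'M[R]_n1) (Sigma2 T Tplus Tminus : 'M[R]_n2)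
    (beta alpha gamma c : R)
    (x : nat -> 'cV[R]_n1) (y : nat -> 'cV[R]_n2) (lambda : nat -> 'cV[R]_m)
    (hp : proper_closed_convex p) (hf : convex_lipschitz_gradient f)
    (hh : proper_closed_convex h) (hg : convex_lipschitz_gradient g)
    (hopt : optimal_set (composite p f) (composite h g) A B b !=set0)
    (hSigma1 : convexity_matrix (composite p f) Sigma1)
    (hSigma2 : convexity_matrix (composite h g) Sigma2)
    (hbeta : 0 < beta)
    (hD : domD alpha gamma)
    (hc : admissible_c alpha gamma c)
    (hS : S^T = S) (hT : T^T = T)
    (hTpm : T = Tplus - Tminus) (hTplus : psd Tplus) (hTminus : psd Tminus)
    (hiter : iPSPR (composite p f) (composite h g) A B b
               beta alpha gamma S T x y lambda)
    (hS1 : psd (S + 2^-1 *: Sigma1))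
    (hS2 : pd (S + 2^-1 *: Sigma1 + beta *: (A^T *m A)))
    (hT1 : pd (T + Sigma2 + ((1 - alpha) * beta) *: (B^T *m B)))
    (hT2 : pd (T + 2^-1 *: Sigma2
               + kappa1 alpha gamma *: (- (2 *: Tminus) + Sigma2)
               + (kappa2 alpha gamma c * beta) *: (B^T *m B))) :
  exists2 w, optimal_set (composite p f) (composite h g) A B b w
           & (x k, y k, lambda k) @[k --> \oo] --> w.
Proof.
have [pp cp vp] := hp; have [ph ch vh] := hh.
have [fp fd _] := hf; have [gp gd _] := hg.
have pr1 := composite_proper f pp; have pr2 := composite_proper g ph.
have cv1 := composite_convex pp vp fp; have cv2 := composite_convex ph vh gp.
have seq := iPSPR_optimality_sequence pr1 cv1 pr2 cv2 hS hT hiter.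
have hag : 0 < alpha + gamma by case/and5P: hD.
apply: (optimality_sequence_cvg hbeta hag hS hT hTpm hTplus hTminus
  hSigma1 hSigma2 seq hD hc hS1 hS2 hT1 hT2) => //.
- by move=> F u xi u0 xi0 FF; exact: subdifferential_closed.
- by move=> F u xi u0 xi0 FF; exact: subdifferential_closed.
Qed.
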